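(* Let $X=\{\bar 1,\bar 2,\dots,\bar n,\dots\}\cup\{\underline 1,\underline 2,\dots,\underline n,\dots\}$ be the disjoint union of two copies of $\mathbb{N}$, endowed with the graph structure in which each $\underline i$ is adjacent to $\bar j$ if and only if $j\ge i$, and there are no other edges; let $d$ be the graph distance on $X$. Then $\lim_{i\to\infty}d(\underline j,\bar i)=1$ for every $j\in\mathbb{N}$, $\lim_{j\to\infty}d(\underline j,\bar i)=3$ for every $i\in\mathbb{N}$, and $d(\underline i,\underline j)=2$ and $d(\bar i,\bar j)=2$ for all $i\ne j$. Therefore both copies of $\mathbb{N}$, namely $\{\bar n:n\in\mathbb{N}\}$ and $\{\underline n:n\in\mathbb{N}\}$ with the metric $d$, are equilateral and thus embed isometrically into $\ell_1$. On the other hand, the distortion of any embedding of $(X,d)$ into $L_1$ is at least $3$.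
   Context: The graph distance between two vertices is the number of edges in a shortest path joining them. A metric space is equilateral if all distances between distinct points are equal. $\ell_1$ is the space of absolutely summable real sequences and $L_1=L_1(\mathbb{R})$ is the space of (classes of) integrable real functions on $\mathbb{R}$, each with the metric given by its norm. Embedding means bilipschitz embedding: an injective map $F:(X,d_X)\to(Y,d_Y)$ between metric spaces is a bilipschitz embedding if there are constants $C_1,C_2>0$ with $C_1d_X(u,v)\le d_Y(F(u),F(v))\le C_2d_X(u,v)$ for all $u,v\in X$; its distortion is $\mathrm{Lip}(F)\cdot\mathrm{Lip}(F^{-1}|_{F(X)})$, where $\mathrm{Lip}$ denotes the Lipschitz constant. *)

(* Defs.v *)
From HB Require Import structures.
From mathcomp Require Import all_boot all_order all_algebra.
From mathcomp Require Import all_classical all_reals all_analysis.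
From mathcomp Require Import measurable_realfun.

Set Implicit Arguments.
Unset Strict Implicit.
Unset Printing Implicit Defensive.

Import Order.TTheory GRing.Theory Num.Theory.
Import numFieldNormedType.Exports.
Local Open Scope classical_set_scope.
Local Open Scope ring_scope.

Section GraphDistance.
Variables (V : eqType) (e : rel V).

Definition is_path (x y : V) (p : seq V) : bool :=
  [&& path e x p, uniq (x :: p) & last x p == y].

Definition graph_connected : Prop := forall x y, exists p, is_path x y p.

Definition path_length (x y : V) : pred nat :=
  fun n => `[< exists2 p, is_path x y p & size p = n >].

Lemma ex_path_length (conn : graph_connected) x y : exists n, path_length x y n.
Proof.
by have [p xpy] := conn x y; exists (size p); apply/asboolP; exists p.
Qed.

Definition graph_dist (conn : graph_connected) (x y : V) : nat :=
  ex_minn (ex_path_length conn x y).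

Hypothesis conn : graph_connected.

Lemma walk_is_path x p : path e x p ->
  exists2 q, is_path x (last x p) q & (size q <= size p)%N.
Proof.
move=> /shortenP[q xq uq sq]; exists q; first by apply/and3P.
by have [] := andP uq => _ /uniq_leq_size; apply.
Qed.

Lemma graph_dist_le x p : path e x p ->
  (graph_dist conn x (last x p) <= size p)%N.
Proof.
move=> /walk_is_path[q qP]; apply: leq_trans; rewrite /graph_dist.
by case: ex_minnP => m _; apply; apply/asboolP; exists q.
Qed.

Lemma graph_distP x y :
  exists2 p, is_path x y p & size p = graph_dist conn x y.
Proof. by rewrite /graph_dist; case: ex_minnP => m /asboolP. Qed.

Lemma graph_distxx x : graph_dist conn x x = 0%N.
Proof. by apply/eqP; rewrite -leqn0 (@graph_dist_le x [::]). Qed.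

Lemma graph_dist_eq0 x y : graph_dist conn x y = 0%N -> x = y.
Proof.
by have [p /and3P[_ _ /eqP <-] <-] := graph_distP x y; move/size0nil ->.
Qed.

Lemma graph_dist_triangle y x z :
  (graph_dist conn x z <= graph_dist conn x y + graph_dist conn y z)%N.
Proof.
have [p /and3P[xp _ /eqP py] <-] := graph_distP x y.
have [q /and3P[yq _ /eqP <-] <-] := graph_distP y z.
rewrite -{1}py -last_cat -size_cat; apply: graph_dist_le.
by rewrite cat_path xp py.
Qed.

Lemma graph_dist_sym (e_sym : symmetric e) x y :
  graph_dist conn x y = graph_dist conn y x.
Proof.
wlog suff le_d : x y / (graph_dist conn x y <= graph_dist conn y x)%N.
  by apply/eqP; rewrite eqn_leq !le_d.
have [p /and3P[yp _ /eqP px] <-] := graph_distP y x.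
have py : last x (rev (belast y p)) = y.
  by rewrite -px; case: (p) => //= a s; rewrite rev_cons last_rcons.
rewrite -{1}py -(size_belast y p) -size_rev; apply: graph_dist_le.
rewrite -px rev_path (eq_path (e' := e)) // => a b; exact: e_sym.
Qed.

End GraphDistance.

(* The carrier mentions R, and the two properties making the graph distance a
   metric, so that the metric structure below can be inferred from the type. *)
Definition graph_space (R : realType) (V : choiceType) (e : rel V)
  (e_sym : symmetric e) (conn : graph_connected e) : Type := V.

Section GraphMetric.
Variables (R : realType) (V : choiceType) (e : rel V).
Variables (e_sym : symmetric e) (conn : graph_connected e).
Let X := graph_space R e_sym conn.

Let dist (x y : X) : R := (graph_dist conn x y)%:R.

Let distxx x : dist x x = 0. Proof. by rewrite /dist graph_distxx. Qed.

Let dist_positivity x y : dist x y = 0 -> x = y.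
Proof. by move=> /eqP; rewrite pnatr_eq0 => /eqP /graph_dist_eq0. Qed.

Let dist_sym x y : dist x y = dist y x.
Proof. by rewrite /dist graph_dist_sym. Qed.

Let dist_triangle y x z : dist x z <= dist x y + dist y z.
Proof. by rewrite /dist -natrD ler_nat graph_dist_triangle. Qed.

HB.instance Definition _ := Choice.on X.
HB.instance Definition _ :=
  @isMetric.Build R X dist distxx dist_positivity dist_sym dist_triangle.

End GraphMetric.

(* [inl n] and [inr n] stand for the overlined and the underlined n; the natural
   numbers start at 0 here, adjacency depending only on the order of indices. *)
Definition half_adj (u v : nat + nat) : bool :=
  match u, v with
  | inr i, inl j | inl j, inr i => (i <= j)%N
  | _, _ => false
  end.

Lemma half_adj_sym : symmetric half_adj.
Proof. by move=> [i|i] [j|j]. Qed.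

Lemma half_adj_connected : graph_connected half_adj.
Proof.
suff walk u v : exists2 p, path half_adj u p & last u p = v.
  move=> u v; have [p up <-] := walk u v.
  by have [q uq _] := walk_is_path up; exists q.
case: u v => [i|i] [j|j].
- by exists [:: inr 0%N; inl j].
- by exists [:: inr 0%N; inl j; inr j]; rewrite //= leqnn.
- by exists [:: inl i; inr 0%N; inl j]; rewrite //= leqnn.
- by exists [:: inl (maxn i j); inr j]; rewrite //= leq_maxl leq_maxr.
Qed.

Definition half_graph (R : realType) : metricType R :=
  graph_space R half_adj_sym half_adj_connected.

Definition upper (R : realType) (n : nat) : half_graph R := inl n.
Definition lower (R : realType) (n : nat) : half_graph R := inr n.

Record ell1 (R : realType) := Ell1 {
  ell1_seq :> nat -> R;
  ell1_summable : cvgn [normed series ell1_seq]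
}.

Section Ell1Metric.
Variable R : realType.
Implicit Types u v w : ell1 R.

Let ell1_norm (a : R^nat) : R := limn [normed series a].

Let dist u v : R := ell1_norm (fun n : nat => u n - v n).

Lemma ell1_summableB u v :
  cvgn [normed series (fun n => u n - v n)].
Proof.
apply: (@series_le_cvg R (fun n => `|u n - v n|)
  (fun n => `|u n| + `|v n|)) => [n|n|n|].
- exact: normr_ge0.
- exact: addr_ge0.
- exact: ler_normB.
- have -> : series (fun n => `|u n| + `|v n|) =
      [normed series u] + [normed series v].
    by apply/funext => n; rewrite /normed_series_of /series /= big_split.
  by apply: is_cvgD; [exact: (@ell1_summable R u)|exact: (@ell1_summable R v)].
Qed.

Let distxx u : dist u u = 0.
Proof.
rewrite /dist /ell1_norm; apply/cvg_lim => //.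
have -> : [normed series (fun n => u n - u n)] = cst 0.
  apply/funext => n; rewrite /normed_series_of /series /= big1 // => i _.
  by rewrite subrr normr0.
exact: cvg_cst.
Qed.

Let dist_positivity u v : dist u v = 0 -> u = v.
Proof.
move=> uv0.
suff uv : u = v :> (nat -> R).
  case: u v uv {uv0} => a ca [b cb] /= ab; subst b.
  by congr Ell1; exact: Prop_irrelevance.
apply/funext => n; apply/eqP.
rewrite -subr_eq0 -normr_le0 -uv0 /dist /ell1_norm.
have nd : nondecreasing_seq [normed series (fun n => u n - v n)].
  apply/nondecreasing_seqP => k.
  by rewrite /normed_series_of /series /= big_nat_recr //= lerDl.
apply: le_trans (nondecreasing_cvgn_le nd (@ell1_summableB u v) n.+1).
by rewrite /normed_series_of /series /= big_nat_recr //= lerDr sumr_ge0.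
Qed.

Let dist_sym u v : dist u v = dist v u.
Proof.
rewrite /dist /ell1_norm; congr (limn (series _)); apply/funext => n /=.
exact: distrC.
Qed.

Let dist_triangle v u w : dist u w <= dist u v + dist v w.
Proof.
have uv := @ell1_summableB u v; have vw := @ell1_summableB v w.
rewrite /dist /ell1_norm -limD //; apply: ler_lim.
- exact: ell1_summableB.
- exact: is_cvgD.
- apply: nearW => n; rewrite fctE /normed_series_of /series /= -big_split /=.
  apply: ler_sum => i _.
  exact: ler_distD.
Qed.

HB.instance Definition _ := gen_eqMixin (ell1 R).
HB.instance Definition _ := gen_choiceMixin (ell1 R).
HB.instance Definition _ := @isMetric.Build R (ell1 R)
  dist distxx dist_positivity dist_sym dist_triangle.

End Ell1Metric.

Definition L1 (R : realType) : Type := LspaceType1 (@lebesgue_measure R).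

Section L1Metric.
Variable R : realType.
Let mu := @lebesgue_measure R.
Implicit Types f g h : L1 R.

(* The class [f] coerces to its chosen representative; [dist] does not depend
   on that choice. *)
Let diff f g : R -> R := fun x => (f x : R) - (g x : R).

Let dist f g : R := fine ('N[mu]_1 [EFin \o diff f g])%E.

Let mL1 f : measurable_fun [set: R] (f : R -> R).
Proof. exact: (measurable_funPT (repr (LebesgueSpace.sort f))). Qed.

Let mdiff f g : measurable_fun [set: R] (diff f g).
Proof. by apply: measurable_funB; exact: mL1. Qed.

Let diffN f g : (EFin \o diff f g = \- (EFin \o diff g f))%E.
Proof. by apply/funext => x; rewrite /diff /= -(opprB (g x)) EFinN. Qed.

Let diff_triangle g f h :
  ('N[mu]_1 [EFin \o diff f h] <=
   'N[mu]_1 [EFin \o diff f g] + 'N[mu]_1 [EFin \o diff g h])%E.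
Proof.
have -> : diff f h = diff f g \+ diff g h.
  by apply/funext => x; rewrite /diff /= addrA subrK.
exact: (eminkowski mu (mdiff f g) (mdiff g h) (lexx 1%E)).
Qed.

Let dist_fin f g : ('N[mu]_1 [EFin \o diff f g])%E \is a fin_num.
Proof.
rewrite ge0_fin_numE ?Lnorm_ge0 //.
have mNg : measurable_fun [set: R] (fun x => - (g x : R)).
  by apply: measurableT_comp => //; exact: mL1.
apply: le_lt_trans (eminkowski mu (mL1 f) mNg (lexx 1%E)) _.
have -> : EFin \o (fun x => - (g x : R)) = (\- (EFin \o (g : R -> R)))%E.
  by apply/funext => x; rewrite /= EFinN.
by rewrite oppe_Lnorm lte_add_pinfty //; exact: Lebesgue_finite.
Qed.

Let distxx f : dist f f = 0.
Proof.
rewrite /dist (_ : EFin \o _ = cst 0%E) ?Lnorm0 //.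
by apply/funext => x; rewrite /diff /= subrr.
Qed.

Let dist_positivity f g : dist f g = 0 -> f = g.
Proof.
move=> fg0.
have fgae : ae_eq mu [set: R] (f : R -> R) (g : R -> R).
  have /measurable_EFinP mfg := mdiff f g.
  have := @Lnorm_eq0_eq0 _ _ _ mu _ 1%E mfg lte01.
  rewrite -(fineK (dist_fin f g)) -/(dist f g) fg0 => /(_ erefl).
  by apply: filterS => x /[apply] -[] /eqP; rewrite subr_eq0 => /eqP.
have : LebesgueSpace.sort f = LebesgueSpace.sort g.
  rewrite -[LHS]reprK -[RHS]reprK; apply/eqmodP; exact/asboolP.
case: (f) (g) => a [[ca]] [b [[cb]]] /= ab.
by subst b; rewrite (Prop_irrelevance ca cb).
Qed.

Let dist_sym f g : dist f g = dist g f.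
Proof. by rewrite /dist diffN oppe_Lnorm. Qed.

Let dist_triangle g f h : dist f h <= dist f g + dist g h.
Proof.
by rewrite -fineD // fine_le // ?fin_numD ?dist_fin // diff_triangle.
Qed.

HB.instance Definition _ := gen_eqMixin (L1 R).
HB.instance Definition _ := gen_choiceMixin (L1 R).
HB.instance Definition _ := @isMetric.Build R (L1 R)
  dist distxx dist_positivity dist_sym dist_triangle.

End L1Metric.

Section Embeddings.
Variables (R : realType) (T U : metricType R).
Implicit Types (A : set T) (F : T -> U).

Definition equilateral A : Prop :=
  exists c : R, forall x y, A x -> A y -> x <> y -> mdist x y = c.

Definition isometry_on A F : Prop :=
  forall x y, A x -> A y -> mdist (F x) (F y) = mdist x y.

Definition bilipschitz_embedding F : Prop :=
  injective F /\ exists C1 C2 : R, [/\ 0 < C1, 0 < C2 & forall u v,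
    C1 * mdist u v <= mdist (F u) (F v) <= C2 * mdist u v].

(* +oo when F is not Lipschitz on A *)
Definition Lip A F : \bar R :=
  ereal_inf [set k%:E | k in [set k : R | 0 <= k /\
    forall x y, A x -> A y -> mdist (F x) (F y) <= k * mdist x y]].

End Embeddings.

(* [x0] is only the value of the inverse of F outside of its range, where the
   Lipschitz constant does not look. *)
Definition distortion (R : realType) (T U : metricType R) (x0 : T)
    (F : T -> U) : \bar R :=
  (Lip [set: T] F * Lip (range F) ('pinv_(fun=> x0) [set: T] F))%E.

(* Main.v *)
Require Import Defs.
From HB Require Import structures.
From mathcomp Require Import all_boot all_order all_algebra.
From mathcomp Require Import all_classical all_reals all_analysis.
From mathcomp Require Import measurable_realfun ring lra.

(* The L1 distance is of negative type: it is the integral over x of the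
   distances |f x - g x| on the line, and |s - t| = s + t - 2 min(s, t), where
   min is a positive semidefinite kernel up to translation.  Hence convex
   combinations of the points x_i = F(underlined i) behave as in a Hilbert
   space whose squared distance is the L1 distance: by the parallelogram law,
   near-minimizers of a quadratic functional over the convex hulls of the tails
   (x_i)_(i >= k) are close to each other.  Take two of them, s and t, and j
   such that all indices of s are at most j and all those of t exceed j.
   Being close, they have nearly the same mean distance to y_j = F(overlined j);
   but this mean is at most Lip F for s and at least 3 / Lip F^-1 for t. *)

Set Implicit Arguments.
Unset Strict Implicit.
Unset Printing Implicit Defensive.

Import Order.TTheory GRing.Theory Num.Theory.
Import numFieldNormedType.Exports.
Local Open Scope classical_set_scope.
Local Open Scope ring_scope.

(* A list s of pairs (weight, point) stands for the finitely supported signed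
   measure \sum_(a <- s) a.1 delta_(a.2). *)
Definition energy {R : realType} {T : Type} (D : T -> T -> R)
    (s t : seq (R * T)) : R :=
  \sum_(a <- s) \sum_(b <- t) a.1 * b.1 * D a.2 b.2.

Definition mass {R : realType} {T : Type} (s : seq (R * T)) : R :=
  \sum_(a <- s) a.1.

Definition scale {R : realType} {T : Type} (c : R) (s : seq (R * T)) :=
  [seq (c * a.1, a.2) | a <- s].

(** By Schoenberg's theorem, the symmetric [D] with zero diagonal that satisfy this are the squared
    Hilbert distances: a measure of mass zero then has as energy minus twice a squared norm. *)
Definition negative_type {R : realType} {T : Type} (D : T -> T -> R) : Prop :=
  forall s : seq (R * T), mass s = 0 -> energy D s s <= 0.

(** * Bilinear calculus of energies *)

Section Energy.
Variables (R : realType) (T : Type) (D : T -> T -> R).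
Implicit Types (s t : seq (R * T)) (c : R).

Lemma mass_cat s t : mass (s ++ t) = mass s + mass t.
Proof. exact: big_cat. Qed.

Lemma mass_scale c s : mass (scale c s) = c * mass s.
Proof. by rewrite /mass big_map mulr_sumr. Qed.

Lemma energy_catl s s' t : energy D (s ++ s') t = energy D s t + energy D s' t.
Proof. exact: big_cat. Qed.

Lemma energy_catr s t t' : energy D s (t ++ t') = energy D s t + energy D s t'.
Proof.
by rewrite /energy -big_split; apply: eq_bigr => a _; rewrite big_cat.
Qed.

Lemma energy_scalel c s t : energy D (scale c s) t = c * energy D s t.
Proof.
rewrite /energy big_map mulr_sumr; apply: eq_bigr => a _.
by rewrite mulr_sumr; apply: eq_bigr => b _; rewrite !mulrA.
Qed.

Lemma energy_scaler c s t : energy D s (scale c t) = c * energy D s t.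
Proof.
rewrite /energy mulr_sumr; apply: eq_bigr => a _.
by rewrite big_map mulr_sumr; apply: eq_bigr => b _ /=; ring.
Qed.

Lemma energyC s t : (forall x y, D x y = D y x) -> energy D s t = energy D t s.
Proof.
move=> DC; rewrite /energy exchange_big; apply: eq_bigr => b _.
by apply: eq_bigr => a _; rewrite DC (mulrC a.1).
Qed.

Lemma energy_catE s t : (forall x y, D x y = D y x) ->
  energy D (s ++ t) (s ++ t) = energy D s s + 2 * energy D s t + energy D t t.
Proof.
by move=> DC; rewrite energy_catl !energy_catr (energyC t s DC); ring.
Qed.

Lemma energy_seq1 s c x :
  energy D s [:: (c, x)] = c * \sum_(a <- s) a.1 * D a.2 x.
Proof.
rewrite /energy mulr_sumr; apply: eq_bigr => a _.
by rewrite big_seq1 /= (mulrC a.1) mulrA.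
Qed.

End Energy.

(** The measure is pushed forward along [f], which keeps its mass. *)
Lemma negative_type_comp (R : realType) (T U : Type) (D : T -> T -> R)
  (f : U -> T) : negative_type D -> negative_type (fun u v => D (f u) (f v)).
Proof.
move=> Dneg s s0; have := Dneg [seq (a.1, f a.2) | a <- s].
rewrite /mass /energy !big_map => /(_ s0).
by under eq_bigr do rewrite big_map.
Qed.

(** * Negative type of the distance on the line *)

Section RealLine.
Variable R : realType.
Implicit Types (s : seq (R * R)) (a : R * R).

Let minE (x y : R) : `|x - y| = x + y - 2 * Num.min x y.
Proof. by case: (leP x y) => xy; [rewrite ler0_norm|rewrite gtr0_norm]; lra. Qed.

(** On points at least [a.2], the minimum is the constant [a.2] plus the overlap length of the
    intervals from [a.2] to the two points, a Gram kernel. The constant contributes the left side;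
    keeping it, instead of bounding by 0, makes the induction work for points of any sign. *)
Lemma energy_min_sorted a s : path (relpre snd <=%R) a s ->
  a.2 * mass (a :: s) ^+ 2 <= energy Num.min (a :: s) (a :: s).
Proof.
elim: s a => [|b s IHs] a /=.
  by rewrite /mass /energy !big_seq1 /= minxx; nra.
move=> /andP[ab pbs]; have {IHs} := IHs b pbs.
set s' := b :: s => IH.
have le_a : forall x, x \in s' -> a.2 <= x.2.
  have : path (relpre snd <=%R) a s' by rewrite /= ab pbs.
  rewrite (path_sortedE (fun x y z => @le_trans _ _ x.2 y.2 z.2)).
  by move=> /andP[/allP].
have amin x : x \in s' -> Num.min a.2 x.2 = a.2 by move=> /le_a/min_l.
rewrite -cat1s mass_cat !energy_catl !energy_catr.
rewrite (energyC s' [:: a]); last by move=> *; exact: minC.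
have -> : energy Num.min [:: a] s' = a.1 * a.2 * mass s'.
  rewrite /energy big_seq1 /mass mulr_sumr big_seq [RHS]big_seq.
  by apply: eq_bigr => x xs; rewrite amin// mulrAC.
have -> : energy Num.min [:: a] [:: a] = a.1 ^+ 2 * a.2.
  by rewrite /energy !big_seq1 minxx.
have -> : mass [:: a] = a.1 by rewrite /mass big_seq1.
have : a.2 * mass s' ^+ 2 <= b.2 * mass s' ^+ 2 by rewrite ler_wpM2r ?sqr_ge0.
lra.
Qed.

Lemma abs_negative_type : negative_type (fun x y : R => `|x - y|).
Proof.
move=> s s0.
have -> : energy (fun x y : R => `|x - y|) s s = - 2 * energy Num.min s s.
  (* Each of the two linear terms of [minE] has [mass s] as a factor. *)
  have zl : \sum_(a <- s) \sum_(b <- s) a.1 * b.1 * a.2 = 0.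
    rewrite big1// => a _.
    transitivity (a.1 * a.2 * mass s); last by rewrite s0 mulr0.
    by rewrite /mass mulr_sumr; apply: eq_bigr => b _; rewrite mulrAC.
  have zr : \sum_(a <- s) \sum_(b <- s) a.1 * b.1 * b.2 = 0.
    rewrite -[RHS]zl exchange_big.
    by do 2!apply: eq_bigr => ? _; rewrite (mulrC _.1).
  transitivity (\sum_(a <- s) \sum_(b <- s) a.1 * b.1 * a.2 +
    \sum_(a <- s) \sum_(b <- s) a.1 * b.1 * b.2 + - 2 * energy Num.min s s).
    rewrite /energy mulr_sumr -!big_split; apply: eq_bigr => a _ /=.
    rewrite mulr_sumr -!big_split; apply: eq_bigr => b _ /=.
    by rewrite minE; ring.
  by rewrite zl zr !add0r.
suff : 0 <= energy Num.min s s by lra.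
(* Sorting preserves energy and mass; for mass zero the bound of [energy_min_sorted] is 0. *)
have tot : total (relpre snd <=%R : rel (R * R)) by move=> x y; exact: le_total.
have /permPl ps := perm_sort (relpre snd <=%R : rel (R * R)) s.
have srt := sort_sorted tot s.
have -> : energy Num.min s s = energy Num.min
    (sort (relpre snd <=%R) s) (sort (relpre snd <=%R) s).
  by rewrite /energy (perm_big _ ps); apply: eq_bigr => a _; rewrite (perm_big _ ps).
have : mass (sort (relpre snd <=%R) s) = 0 by rewrite -s0 /mass (perm_big _ ps).
case: (sort _ _) srt => [|a t] /=; first by rewrite /energy big_nil.
by move=> /energy_min_sorted + t0; rewrite t0 expr0n mulr0.
Qed.

End RealLine.

(** * Integrals of kernels of negative type *)

Section Integral.
Context d (T : measurableType d) (R : realType).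
Variable mu : {measure set T -> \bar R}.

Lemma energy_Rintegral (U : Type) (ev : U -> T -> R) (s : seq (R * U)) :
  (forall u v, mu.-integrable [set: T] (fun x => `|ev u x - ev v x|%:E)) ->
  energy (fun u v => \int[mu]_x `|ev u x - ev v x|) s s =
  \int[mu]_x energy (fun u v => `|ev u x - ev v x|) s s.
Proof.
move=> intD.
have intZ c u v : mu.-integrable [set: T] (fun x => (c * `|ev u x - ev v x|)%:E).
  under eq_fun do rewrite EFinM.
  exact: integrableZl.
have intS (a : R * U) : mu.-integrable [set: T]
    (fun x => \sum_(b <- s) (a.1 * b.1 * `|ev a.2 x - ev b.2 x|)%:E)%E.
  by apply: integrable_sum => // b _; exact: intZ.
rewrite /Rintegral /energy.
under [in RHS]eq_integral do rewrite -sumEFin.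
under [in RHS]eq_integral do under eq_bigr do rewrite -sumEFin.
rewrite integral_sum//; under [in RHS]eq_bigr do rewrite integral_sum//.
rewrite -sum_fine => [|a _]; last first.
  rewrite -integral_sum//; exact: integrable_fin_num.
apply: eq_bigr => a _; rewrite -sum_fine => [|b _]; last first.
  exact: integrable_fin_num.
apply: eq_bigr => b _.
rewrite -RintegralZl//; last exact: intD.
Qed.

(** For fixed [x] the integrand is the distance on the line pulled back along evaluation at [x], so
    the energy under the integral is pointwise nonpositive. *)
Lemma Rintegral_negative_type (U : Type) (ev : U -> T -> R) :
  (forall u v, mu.-integrable [set: T] (fun x => `|ev u x - ev v x|%:E)) ->
  negative_type (fun u v => \int[mu]_x `|ev u x - ev v x|).
Proof.
move=> intD s s0.
have absneg x : energy (fun u v => `|ev u x - ev v x|) s s <= 0.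
  exact: (negative_type_comp (ev^~ x) (@abs_negative_type R) s0).
rewrite energy_Rintegral// fine_le0//.
under eq_integral do rewrite -[energy _ _ _]opprK EFinN.
have absneg' x : (0 <= (- energy (fun u v => `|ev u x - ev v x|) s s)%:E)%E.
  by rewrite lee_fin oppr_ge0.
by rewrite integral_ge0N// oppe_le0 integral_ge0.
Qed.
End Integral.

(** * Negative type of the L1 distance *)

Section L1.
Variable R : realType.
Let mu := @lebesgue_measure R.

Lemma mdist_L1 (f g : L1 R) : mdist f g = \int[mu]_x `|(f x : R) - g x|.
Proof.
transitivity (fine ('N[mu]_1 [EFin \o (fun x => ((f x : R) - g x)%R)])%E) => //.
by rewrite Lnorm1.
Qed.

Lemma L1_integrable (f : L1 R) : mu.-integrable [set: R] (fun x => (f x : R)%:E).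
Proof.
apply/integrableP; split.
  apply/measurable_EFinP; exact: (measurable_funPT (repr (LebesgueSpace.sort f))).
have : ('N[mu]_1 [EFin \o (f : R -> R)] < +oo)%E by exact: Lebesgue_finite.
by rewrite Lnorm1.
Qed.

Lemma L1_negative_type : negative_type (fun f g : L1 R => mdist f g).
Proof.
have -> : (fun f g : L1 R => mdist f g) =
    (fun f g => \int[mu]_x `|(f x : R) - g x|).
  by apply/funext => f; apply/funext => g; exact: mdist_L1.
apply: (@Rintegral_negative_type _ _ _ mu (L1 R) (fun (f : L1 R) (x : R) => f x : R)).
move=> f g.
have : mu.-integrable [set: R] (fun x => (f x : R)%:E - (g x : R)%:E)%E.
  by apply: integrableB => //; exact: L1_integrable.
exact: integrable_abse.
Qed.
End L1.

(** * Stability of bounded kernels of negative type *)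

Section Stability.
Variables (R : realType) (T : Type) (D : T -> T -> R).
Hypothesis DC : forall x y, D x y = D y x.
Hypothesis Dneg : negative_type D.
Implicit Types s t : seq (R * nat).

Let at_ (x : nat -> T) s : seq (R * T) := [seq (a.1, x a.2) | a <- s].

(** Weights are carried by indices, not by points, so that tails make sense even for a sequence that
    repeats points. *)
Definition tail_convex (k : nat) s : Prop :=
  (forall a, a \in s -> 0 <= a.1 /\ (k <= a.2)%N) /\ mass s = 1.

Definition midpoint s t := scale 2^-1 s ++ scale 2^-1 t.

Lemma tail_convexS k l s : (k <= l)%N -> tail_convex l s -> tail_convex k s.
Proof.
move=> kl [sl s1]; split => // a /sl[a0 la]; split => //.
exact: leq_trans kl la.
Qed.

Lemma tail_convex_midpoint k s t :
  tail_convex k s -> tail_convex k t -> tail_convex k (midpoint s t).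
Proof.
move=> [sk s1] [tk t1]; split; last by rewrite mass_cat !mass_scale s1 t1; lra.
move=> a; rewrite mem_cat => /orP[] /mapP[b] => [/sk|/tk] [b0 kb] -> /=;
  by split=> //; rewrite mulr_ge0// invr_ge0.
Qed.

Lemma tail_convex_dirac k : tail_convex k [:: (1, k)].
Proof.
split; last by rewrite /mass big_seq1.
by move=> a; rewrite inE => /eqP -> /=.
Qed.

Lemma tail_convex_mean_le (h : nat -> R) c k s : tail_convex k s ->
  (forall a, a \in s -> h a.2 <= c) -> \sum_(a <- s) a.1 * h a.2 <= c.
Proof.
move=> [sk s1] hc; rewrite -[leRHS]mul1r -s1 /mass mulr_suml.
rewrite big_seq [leRHS]big_seq; apply: ler_sum => a ain.
by apply: ler_wpM2l; [have [] := sk a ain|exact: hc].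
Qed.

Lemma tail_convex_mean_ge (h : nat -> R) c k s : tail_convex k s ->
  (forall a, a \in s -> c <= h a.2) -> c <= \sum_(a <- s) a.1 * h a.2.
Proof.
move=> [sk s1] hc; rewrite -[leLHS]mul1r -s1 /mass mulr_suml.
rewrite big_seq [leRHS]big_seq; apply: ler_sum => a ain.
by apply: ler_wpM2l; [have [] := sk a ain|exact: hc].
Qed.

(** The infima of [Phi] over the tails increase as the tails shrink, and Dirac masses keep them
    below [c]. With [m] an infimum within [e / 2] of their supremum, every infimum is below
    [m + e / 2], and an approximate minimizer costs another [e / 2]. *)
Lemma near_minimizers (Phi : seq (R * nat) -> R) (b e : R) : 0 < e ->
  (forall s, tail_convex 0 s -> b <= Phi s) ->
  (exists c, forall k, Phi [:: (1, k)] <= c) ->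
  exists k m, (forall s, tail_convex k s -> m <= Phi s) /\
    forall l, exists2 s, tail_convex l s & Phi s <= m + e.
Proof.
move=> e0 Phib [c Phic].
pose A k := [set r | exists2 s, tail_convex k s & r = Phi s].
have A0 k : A k !=set0.
  by exists (Phi [:: (1, k)]), [:: (1, k)] => //; exact: tail_convex_dirac.
have Alb k : has_lbound (A k).
  by exists b => _ [s sk ->]; apply: Phib; exact: tail_convexS sk.
have infA k : has_inf (A k) by split.
have Ac k : inf (A k) <= c.
  apply: le_trans (Phic k); apply: ge_inf => //.
  by exists [:: (1, k)] => //; exact: tail_convex_dirac.
pose S := [set inf (A k) | k in [set: nat]].
have supS : has_sup S.
  by split; [exists (inf (A 0%N)), 0%N|exists c => _ [k _ <-]].
have [_ [k _ <-] kS] := sup_adherent (divr_gt0 e0 (ltr0Sn R 1)) supS.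
exists k, (inf (A k)); split => [s sk|l].
  by apply: ge_inf => //; exists s.
have [_ [s sl ->] sA] := inf_adherent (divr_gt0 e0 (ltr0Sn R 1)) (infA l).
exists s => //; apply: ltW.
have : inf (A l) <= sup S by apply: sup_upper_bound => //; exists l.
lra.
Qed.

(* A form of Krivine-Maurey stability, which asserts that the two iterated limits
   of D (x i) (y j) agree when they exist. *)
Lemma negative_type_stable (x y : nat -> T) (M alpha beta : R) :
  (forall i j, 0 <= D (x i) (x j) <= M) ->
  (forall i j, 0 <= D (y i) (y j) <= M) ->
  (forall i j, 0 <= D (x i) (y j) <= M) ->
  (forall i j, (i <= j)%N -> D (x i) (y j) <= alpha) ->
  (forall i j, (j < i)%N -> beta <= D (x i) (y j)) ->
  beta <= alpha.
Proof.
move=> Mx My Mxy le_al ge_be; rewrite leNgt; apply/negP => ab.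
pose delta := beta - alpha.
have d0 : 0 < delta by rewrite subr_gt0.
have M0 : 0 <= M by have /andP[] := Mx 0%N 0%N; exact: le_trans.
pose o : seq (R * T) := [:: (1, y 0%N)].
pose f s := energy D (at_ x s) o.
pose E s t := energy D (at_ x s) (at_ x t).
(* The square of f forces near-minimizers to have nearly equal mean distances to
   the base point y 0, so that D may be replaced with a Gram matrix. *)
pose Phi s := f s ^+ 2 - E s s.
have fE s : f s = \sum_(a <- s) a.1 * D (x a.2) (y 0%N).
  by rewrite /f energy_seq1 mul1r big_map.
have at_scale c s : at_ x (scale c s) = scale c (at_ x s).
  by rewrite /at_ /scale -!map_comp.
have at_cat s t : at_ x (s ++ t) = at_ x s ++ at_ x t by rewrite /at_ map_cat.
have EC s t : E s t = E t s by exact: energyC.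
(* For [s] and [t] of equal mass the subtracted bracket acts as the squared norm of [s - t]: by
   negative type, both of its parts are nonnegative. *)
have parallelogram s t : Phi (midpoint s t) = (Phi s + Phi t) / 2 -
    4^-1 * ((f s - f t) ^+ 2 - (E s s - 2 * E s t + E t t)).
  have := EC s t.
  rewrite /Phi /E /f /midpoint at_cat !at_scale.
  rewrite !energy_catl !energy_catr !energy_scalel !energy_scaler.
  by move=> ->; field.
have Ele s : tail_convex 0 s -> E s s <= M.
  move=> s0; rewrite /E /energy big_map /=.
  under eq_bigr do [rewrite big_map;
    under eq_bigr do rewrite -mulrA; rewrite -mulr_sumr /=].
  pose h i := \sum_(b <- s) b.1 * D (x i) (x b.2).
  apply: (tail_convex_mean_le (h := h) s0) => a _.
  apply: (tail_convex_mean_le (h := fun j => D (x a.2) (x j)) s0) => b _.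
  by have /andP[] := Mx a.2 b.2.
(* Small enough for the term in [sigma ^+ 2] to be absorbed at the end; [M + 1] avoids a division by
   zero. *)
pose sigma := delta / (4 * (M + 1)).
have sigma0 : 0 < sigma by rewrite divr_gt0// mulr_gt0//; lra.
have Msigma : 4 * (M * sigma) <= delta.
  have : 4 * ((M + 1) * sigma) = delta by rewrite /sigma; field; lra.
  nra.
(* The bound [6 * e] on [(f s - f t) ^+ 2 + Q] below has to give both [f t - f s <= delta / 4] and
   [Q < sigma * delta]. *)
pose e := Num.min (delta ^+ 2 / 16) (sigma * delta / 2) / 6.
have e0 : 0 < e.
  have dd : 0 < delta ^+ 2 by exact: exprn_gt0.
  have sd : 0 < sigma * delta by exact: mulr_gt0.
  by rewrite divr_gt0// lt_min; apply/andP; split; lra.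
have e1 : 6 * e <= delta ^+ 2 / 16.
  by rewrite /e mulrCA divff ?mulr1 ?ge_min ?lexx.
have e2 : 6 * e < sigma * delta.
  rewrite /e mulrCA divff ?mulr1 ?gt_min; [|lra].
  by apply/orP; right; have := mulr_gt0 sigma0 d0; lra.
have [k [m [mle near_m]]] : exists k m, (forall s, tail_convex k s -> m <= Phi s) /\
    forall l, exists2 s, tail_convex l s & Phi s <= m + e.
  apply: (@near_minimizers Phi (- M)) => //.
    by move=> s /Ele; rewrite /Phi; have := sqr_ge0 (f s); lra.
  exists (M ^+ 2) => i; rewrite /Phi fE big_seq1 /= mul1r.
  have -> : E [:: (1, i)] [:: (1, i)] = D (x i) (x i).
    by rewrite /E /energy !big_seq1 /= !mul1r.
  have /andP[D0 _] := Mx i i; have /andP[F0 FM] := Mxy i 0%N; nra.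
have [s sk sm] := near_m k.
pose j := \max_(a <- s) a.2.
have sj a : a \in s -> (a.2 <= j)%N.
  by move=> sa; rewrite /j (big_rem a)//= leq_maxl.
(* Indices from [k] on keep the midpoint of [s] and [t] in the tail where [m] is a lower bound;
   indices beyond [j] give [t] the estimate by [beta] against [y j]. *)
have [t tj tm] := near_m (maxn k j.+1).
have tk : tail_convex k t by apply: tail_convexS tj; exact: leq_maxl.
have tj' a : a \in t -> (j < a.2)%N.
  by move=> /(tj.1)[_]; apply: leq_trans; exact: leq_maxr.
have mid := mle _ (tail_convex_midpoint sk tk).
rewrite parallelogram in mid.
set Q := - (E s s - 2 * E s t + E t t) in mid.
pose w := at_ x s ++ scale (-1) (at_ x t).
have mass_at r : mass (at_ x r) = mass r by rewrite /mass big_map.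
have w0 : mass w = 0 by rewrite mass_cat mass_scale !mass_at sk.2 tk.2; lra.
have Eww : energy D w w = - Q.
  rewrite /Q /w !energy_catl !energy_catr !energy_scalel !energy_scaler -!/(E _ _).
  by rewrite (EC t s); ring.
have Q0 : 0 <= Q by have := Dneg w0; rewrite Eww oppr_le0.
(* [Phi] is at least [m] at the midpoint and at most [m + e] at [s] and [t], so the bracket is at
   most [4 * e]. *)
have fQ : (f s - f t) ^+ 2 + Q <= 6 * e.
  by move: mid; rewrite -/Q; lra.
have ffd : f t - f s <= delta / 4.
  by have := sqr_ge0 (f s - f t); nra.
pose yj : seq (R * T) := [:: (1, y j)].
have Ls : energy D (at_ x s) yj <= alpha.
  rewrite energy_seq1 mul1r big_map /=.
  apply: (tail_convex_mean_le (h := fun i => D (x i) (y j)) sk) => a /sj.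
  exact: le_al.
have Lt : beta <= energy D (at_ x t) yj.
  rewrite energy_seq1 mul1r big_map /=.
  apply: (tail_convex_mean_ge (h := fun i => D (x i) (y j)) tj) => a /tj'.
  exact: ge_be.
(* Instead of Cauchy-Schwarz, negative type is applied to the measure
   s - t - sigma (delta_(y j) - delta_(y 0)). *)
pose z := scale (- sigma) yj ++ scale sigma o.
have wz0 : mass (w ++ z) = 0.
  by rewrite mass_cat w0 mass_cat !mass_scale /mass !big_seq1; lra.
have := Dneg wz0.
have zz : - (2 * M * sigma ^+ 2) <= energy D z z.
  rewrite /z !energy_catl !energy_catr !energy_scalel !energy_scaler.
  rewrite (energyC o yj)// /energy !big_seq1 /= !mul1r.
  have /andP[? ?] := My j j; have /andP[? ?] := My j 0%N.
  have /andP[? ?] := My 0%N 0%N.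
  have : 0 <= sigma ^+ 2 by exact: sqr_ge0.
  nra.
have wz : energy D w z =
    sigma * ((energy D (at_ x t) yj - energy D (at_ x s) yj) - (f t - f s)).
  rewrite /w /z !energy_catl !energy_catr !energy_scalel !energy_scaler -!/(f _).
  by ring.
rewrite energy_catE// wz Eww.
set A := energy D (at_ x t) yj in Lt *; set B := energy D (at_ x s) yj in Ls *.
move=> bad.
(* The contradiction is [2 * sigma * (3 * delta / 4) <= Q + 2 * M * sigma ^+ 2 < sigma * delta +
   sigma * delta / 2]. *)
have AB : delta * 3 / 4 <= A - B - (f t - f s) by rewrite /delta in ffd *; lra.
have : sigma * (delta * 3 / 4) <= sigma * (A - B - (f t - f s)).
  by rewrite ler_pM2l.
have : sigma * (4 * (M * sigma)) <= sigma * delta by rewrite ler_pM2l.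
have : Q <= 6 * e by have := sqr_ge0 (f s - f t); lra.
nra.
Qed.
End Stability.

(** * Distances in the half graph *)

Section HalfGraph.

Let d := graph_dist half_adj_connected.

Lemma half_dist_le u p v : path half_adj u p -> last u p = v ->
  (d u v <= size p)%N.
Proof. by move=> up <-; exact: graph_dist_le. Qed.

Lemma half_distP u v : exists2 p, is_path half_adj u v p & size p = d u v.
Proof. exact: graph_distP. Qed.

(** No edge stays within a side, while [inl (maxn i j)] is a common neighbour of the two lower
    vertices and [inr 0] is one of the two upper vertices. *)
Lemma half_dist_same_side i j : i <> j ->
  d (inr i) (inr j) = 2 /\ d (inl i) (inl j) = 2.
Proof.
move=> ij; split; apply/eqP; rewrite eqn_leq; apply/andP; split.
- apply: (@half_dist_le _ [:: inl (maxn i j); inr j]) => //=.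
  by rewrite leq_maxl leq_maxr.
- have [p /and3P[pe _ pl] <-] := half_distP (inr i) (inr j).
  by case: p pe pl => [|[k|k] [|w p]] //= _ /eqP[].
- exact: (@half_dist_le _ [:: inr 0%N; inl j]).
- have [p /and3P[pe _ pl] <-] := half_distP (inl i) (inl j).
  by case: p pe pl => [|[k|k] [|w p]] //= _ /eqP[].
Qed.

(** The graph is bipartite, so this distance is odd; for [j < i] a detour through [inr 0], adjacent
    to every upper vertex, has length 3. *)
Lemma half_dist_lower_upper i j :
  d (inr i) (inl j) = if (i <= j)%N then 1 else 3.
Proof.
case: ifP => ij; apply/eqP; rewrite eqn_leq; apply/andP; split.
- by apply: (@half_dist_le _ [:: inl j]) => //=; rewrite ij.
- have [p /and3P[pe _ pl] <-] := half_distP (inr i) (inl j).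
  by case: p pe pl.
- by apply: (@half_dist_le _ [:: inl i; inr 0%N; inl j]); rewrite //= leqnn.
- have [p /and3P[pe _ pl] <-] := half_distP (inr i) (inl j).
  case: p pe pl => [|[k|k] [|[l|l] [|w p]]] //=; rewrite ?andbT ?andbF //.
  by move=> + /eqP[kj]; rewrite kj ij.
Qed.

End HalfGraph.

(** * Limits, equilateral copies and their embeddings into [ell1] *)

Section Half.
Variable R : realType.

Lemma mdist_lower i j : i <> j -> mdist (lower R i) (lower R j) = 2.
Proof. by move=> /half_dist_same_side[+ _] => ijE; congr (_ %:R). Qed.

Lemma mdist_upper i j : i <> j -> mdist (upper R i) (upper R j) = 2.
Proof. by move=> /half_dist_same_side[_ +] => ijE; congr (_ %:R). Qed.

Lemma mdist_lower_upper i j :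
  mdist (lower R i) (upper R j) = if (i <= j)%N then 1 else 3.
Proof.
transitivity ((graph_dist half_adj_connected (inr i) (inl j))%:R : R) => //.
by rewrite half_dist_lower_upper; case: ifP.
Qed.

Lemma mdist_lower_upper_cvg1 j :
  mdist (lower R j) (upper R i) @[i --> \oo] --> (1 : R).
Proof.
apply: cvg_near_cst; exists j => // i /= ji.
by rewrite mdist_lower_upper ji.
Qed.

Lemma mdist_lower_upper_cvg3 i :
  mdist (lower R j) (upper R i) @[j --> \oo] --> (3 : R).
Proof.
apply: cvg_near_cst; exists i.+1 => // j /= ij.
by rewrite mdist_lower_upper leqNgt ij.
Qed.

Lemma equilateral_upper : equilateral (range (upper R)).
Proof.
exists 2 => _ _ [i _ <-] [j _ <-] ij; apply: mdist_upper => ijE.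
by apply: ij; rewrite ijE.
Qed.

Lemma equilateral_lower : equilateral (range (lower R)).
Proof.
exists 2 => _ _ [i _ <-] [j _ <-] ij; apply: mdist_lower => ijE.
by apply: ij; rewrite ijE.
Qed.

Definition unit_seq (n : nat) : nat -> R := fun k => (k == n)%:R.

Lemma cvg_finite_support (a : R^nat) N : (forall k, (N <= k)%N -> a k = 0) ->
  [normed series a] @ \oo --> \sum_(0 <= k < N) `|a k|.
Proof.
move=> a0; apply: cvg_near_cst; exists N => // n /= Nn.
rewrite /normed_series_of /series /= (big_cat_nat (n := N)) //=.
rewrite [X in _ + X = _]big_nat_cond [X in _ + X = _]big1 ?addr0// => k.
by move=> /andP[/andP[Nk _] _]; rewrite a0 ?normr0.
Qed.

Lemma unit_seq_summable n : cvgn [normed series (unit_seq n)].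
Proof.
apply/cvg_ex; exists (\sum_(0 <= k < n.+1) `|unit_seq n k|).
apply: cvg_finite_support => k nk.
by rewrite /unit_seq gtn_eqF.
Qed.

Definition unit_vec n : ell1 R := @Ell1 R (unit_seq n) (@unit_seq_summable n).

Lemma mdist_unit_vec i j : i <> j -> mdist (unit_vec i) (unit_vec j) = 2.
Proof.
move=> /eqP ij.
have -> : mdist (unit_vec i) (unit_vec j) =
  limn [normed series (fun k => unit_seq i k - unit_seq j k)] by [].
set N := (maxn i j).+1.
have /cvg_lim -> // : [normed series (fun k => unit_seq i k - unit_seq j k)] @ \oo -->
  (2 : R).
have -> : 2 = \sum_(0 <= k < N) `|unit_seq i k - unit_seq j k|.
  have iN : (i < N)%N by rewrite ltnS leq_maxl.
  have jN : (j < N)%N by rewrite ltnS leq_maxr.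
  rewrite big_mkord (bigD1 (Ordinal iN))//= (bigD1 (Ordinal jN))//=; last first.
    by rewrite -val_eqE eq_sym.
  rewrite big1 ?addr0 /unit_seq => [|k /andP[]].
    by rewrite !eqxx (negPf ij) eq_sym (negPf ij) subr0 sub0r normrN !normr1.
  by rewrite -!val_eqE /= => /negPf -> /negPf ->; rewrite subrr normr0.
apply: cvg_finite_support => k; rewrite gtn_max => /andP[ik jk].
by rewrite /unit_seq !gtn_eqF ?subrr.
Qed.

(** The standard basis vectors of [ell1] are at mutual distance 2. Both copies share the same
    images, so the map is isometric on each copy but not injective on the graph. *)
Definition unit_embedding (u : half_graph R) : ell1 R :=
  match u : nat + nat with inl n | inr n => unit_vec n end.

Lemma unit_embedding_isometry_upper : isometry_on (range (upper R)) unit_embedding.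
Proof.
move=> _ _ [i _ <-] [j _ <-]; have [<-|/eqP ij] := eqVneq i j.
  by rewrite !mdistxx.
by rewrite mdist_upper//; exact: mdist_unit_vec.
Qed.

Lemma unit_embedding_isometry_lower : isometry_on (range (lower R)) unit_embedding.
Proof.
move=> _ _ [i _ <-] [j _ <-]; have [<-|/eqP ij] := eqVneq i j.
  by rewrite !mdistxx.
by rewrite mdist_lower//; exact: mdist_unit_vec.
Qed.

End Half.

(** * The lower bound on the distortion *)

Section Distortion.
Variable R : realType.

(** Stability is applied to the L1 distance pulled back by [F], with [alpha = k] from pairs at
    distance 1 and [beta = 3 / l] from pairs at distance 3; the diameter 3 gives the bound
    [k * 3]. *)
Lemma half_graph_L1_constants (F : half_graph R -> L1 R) (k l : R) :
  0 <= k -> 0 <= l ->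
  (forall u v, mdist (F u) (F v) <= k * mdist u v) ->
  (forall u v, mdist u v <= l * mdist (F u) (F v)) ->
  3 <= l * k.
Proof.
move=> k0 l0 Fk Fl.
have l_gt0 : 0 < l.
  rewrite lt_neqAle l0 andbT; apply/eqP => l00.
  have := Fl (lower R 0%N) (upper R 0%N).
  by rewrite -l00 mul0r mdist_lower_upper leqnn ler10.
suff : 3 / l <= k by rewrite ler_pdivrMr// mulrC.
have FM u v : 0 <= mdist (F u) (F v) <= k * 3.
  rewrite mdist_ge0 (le_trans (Fk _ _))// ler_wpM2l//.
  have le3 i j : mdist (lower R i) (upper R j) <= 3.
    by rewrite mdist_lower_upper; case: ifP => _; lra.
  case: u v => [i|i] [j|j].
  - have [->|/eqP/(mdist_upper R)] := eqVneq i j; first by rewrite mdistxx.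
    by rewrite /upper => ->; lra.
  - by rewrite metric_sym; exact: le3.
  - exact: le3.
  - have [->|/eqP/(mdist_lower R)] := eqVneq i j; first by rewrite mdistxx.
    by rewrite /lower => ->; lra.
apply: (@negative_type_stable R (half_graph R) (fun u v => mdist (F u) (F v)) _ _
  (lower R) (upper R) (k * 3)) => //.
- by move=> u v; exact: metric_sym.
- exact: (negative_type_comp F (@L1_negative_type R)).
- move=> i j ij; apply: le_trans (Fk _ _) _.
  by rewrite mdist_lower_upper ij mulr1.
- move=> i j ji; have := Fl (lower R i) (upper R j).
  by rewrite mdist_lower_upper leqNgt ji/= ler_pdivrMr// mulrC.
Qed.

(** Passes from products of admissible constants to the product of the two infima: [Lip] of [F] is a
    positive real [inf A], and every admissible [l] for the inverse is at least [c / inf A]. *)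
Lemma distortion_ge (T U : metricType R) (x0 : T) (F : T -> U) (c : R) :
  0 < c -> bilipschitz_embedding F ->
  (forall k l, 0 <= k -> 0 <= l ->
     (forall u v, mdist (F u) (F v) <= k * mdist u v) ->
     (forall u v, mdist u v <= l * mdist (F u) (F v)) -> c <= l * k) ->
  (c%:E <= distortion x0 F)%E.
Proof.
move=> c0 [Finj [C1 [C2 [C10 C20 FC]]]] cP.
have FK : cancel F ('pinv_(fun=> x0) [set: T] F).
  move=> u; apply: pinvKV; rewrite ?inE//; exact: in2W.
rewrite /distortion; set b := Lip (range F) _.
set A := [set k : R | 0 <= k /\ forall x y, [set: T] x -> [set: T] y ->
   mdist (F x) (F y) <= k * mdist x y].
have AC2 : A C2 by split=> [|x y _ _]; [exact: ltW|have /andP[] := FC x y].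
have Alb : has_lbound A by exists 0 => k [].
have infA : has_inf A by split => //; exists C2.
have -> : Lip [set: T] F = (inf A)%:E by rewrite /Lip ereal_inf_EFin //; exists C2.
have bP l : 0 <= l -> (forall x y, range F x -> range F y ->
   mdist ('pinv_(fun=> x0) [set: T] F x) ('pinv_(fun=> x0) [set: T] F y)
     <= l * mdist x y) -> c <= l * inf A.
  move=> l0 lP.
  have lP' u v : mdist u v <= l * mdist (F u) (F v).
    by have := lP (F u) (F v); rewrite !FK; apply; [exists u|exists v].
  have l_gt0 : 0 < l.
    rewrite lt_neqAle l0 andbT; apply/eqP => l00.
    have := cP C2 l (ltW C20) l0 _ lP'; rewrite -l00 mul0r leNgt c0.
    by apply/not_implyP; split => // u v; have /andP[] := FC u v.
  rewrite mulrC -ler_pdivrMr//; apply: lb_le_inf; first by exists C2.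
  move=> k [k0 kP]; rewrite ler_pdivrMr// mulrC; apply: cP => // u v; exact: kP.
have C1P : forall x y, range F x -> range F y ->
   mdist ('pinv_(fun=> x0) [set: T] F x) ('pinv_(fun=> x0) [set: T] F y)
     <= C1^-1 * mdist x y.
  move=> _ _ [u _ <-] [v _ <-]; rewrite !FK mulrC ler_pdivlMr// mulrC.
  by have /andP[] := FC u v.
(* [C1^-1] is admissible for the inverse, whence [0 < c * C1 <= inf A]. *)
have a0 : 0 < inf A.
  have := bP C1^-1 _ C1P; rewrite invr_ge0 (ltW C10) => /(_ isT).
  by rewrite mulrC ler_pdivlMr//; apply: lt_le_trans; rewrite mulr_gt0.
have -> : c = inf A * (c / inf A) by rewrite mulrCA divff ?mulr1// gt_eqF.
rewrite EFinM lee_pmul2l//.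
apply: le_ereal_inf_tmp => _ [l [l0 lP] <-].
by rewrite lee_fin ler_pdivrMr//; exact: bP.
Qed.

End Distortion.

Theorem mainTheorem6 (R : realType) :
  (forall j, mdist (lower R j) (upper R i) @[i --> \oo] --> (1 : R)) /\
  (forall i, mdist (lower R j) (upper R i) @[j --> \oo] --> (3 : R)) /\
  (forall i j, i <> j -> mdist (lower R i) (lower R j) = 2) /\
  (forall i j, i <> j -> mdist (upper R i) (upper R j) = 2) /\
  equilateral (range (upper R)) /\
  equilateral (range (lower R)) /\
  (exists F : half_graph R -> ell1 R, isometry_on (range (upper R)) F) /\
  (exists F : half_graph R -> ell1 R, isometry_on (range (lower R)) F) /\
  (forall (x0 : half_graph R) (F : half_graph R -> L1 R),
     bilipschitz_embedding F -> (3%:E <= distortion x0 F)%E).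
Proof.
split; first exact: mdist_lower_upper_cvg1.
split; first exact: mdist_lower_upper_cvg3.
split; first exact: mdist_lower.
split; first exact: mdist_upper.
split; first exact: equilateral_upper.
split; first exact: equilateral_lower.
split; first by exists (@unit_embedding R); exact: unit_embedding_isometry_upper.
split; first by exists (@unit_embedding R); exact: unit_embedding_isometry_lower.
move=> x0 F FB; apply: distortion_ge => // k l.
exact: half_graph_L1_constants.
Qed.
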